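(* Let $G$ be a strongly topological gyrogroup with a symmetric neighborhood base $\mathscr U$ at $0$ and let $H$ be a locally compact metrizable admissible subgyrogroup of $G$ generated from $\mathscr U$. If the quotient space $G/H$ is strongly Fréchet-Urysohn, then $G$ is also strongly Fréchet-Urysohn.
   Context: All topological spaces are assumed to be Hausdorff. A gyrogroup is a set $G$ with a binary operation $\oplus$ such that: (G1) there is a unique identity element $0\in G$ with $0\oplus a=a=a\oplus 0$ for all $a\in G$; (G2) for each $x\in G$ there is a unique inverse $\ominus x\in G$ with $\ominus x\oplus x=0=x\oplus(\ominus x)$; (G3) for all $x,y\in G$ there is an automorphism $\mathrm{gyr}[x,y]$ of $(G,\oplus)$ with $x\oplus(y\oplus z)=(x\oplus y)\oplus \mathrm{gyr}[x,y](z)$ for all $z\in G$; (G4) $\mathrm{gyr}[x\oplus y,y]=\mathrm{gyr}[x,y]$ for all $x,y\in G$. A topological gyrogroup is a gyrogroup with a topology such that $\oplus:G\times G\to G$ is jointly continuous and $x\mapsto\ominus x$ is continuous. A strongly topological gyrogroup with a symmetric neighborhood base $\mathscr U$ at $0$ is a topological gyrogroup $G$ together with a neighborhood base $\mathscr U$ of $0$ such that for every $U\in\mathscr U$: $\ominus U=U$ and $\mathrm{gyr}[x,y](U)=U$ for all $x,y\in G$. A subgyrogroup of $G$ is a nonempty subset $H$ with $\ominus a\in H$ and $a\oplus b\in H$ for all $a,b\in H$; it is an $L$-subgyrogroup if moreover $\mathrm{gyr}[a,h](H)=H$ for all $a\in G$, $h\in H$. A subgyrogroup $H$ of $G$ is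 an admissible subgyrogroup generated from $\mathscr U$ if there is a sequence $\{U_n:n\in\omega\}$ of open symmetric neighborhoods of $0$ with each $U_n\in\mathscr U$, $U_{n+1}\oplus(U_{n+1}\oplus U_{n+1})\subset U_n$ for each $n\in\omega$, and $H=\bigcap_{n\in\omega}U_n$. Such an $H$ is known to be a closed $L$-subgyrogroup of $G$. For an $L$-subgyrogroup $H$, the set $G/H=\{a\oplus H:a\in G\}$ is a partition of $G$; it carries the quotient topology with respect to $\pi:G\to G/H$, $\pi(a)=a\oplus H$ (i.e. $O\subset G/H$ is open iff $\pi^{-1}(O)$ is open in $G$). Subsets such as $H$ carry the subspace topology. A space $X$ is strongly Fréchet-Urysohn if for every $x\in X$ and every decreasing sequence $\{A_n\}_{n\in\mathbb N}$ of subsets of $X$ with $x\in\bigcap_{n\in\mathbb N}\overline{A_n}$, there exist $x_n\in A_n$ ($n\in\mathbb N$) such that the sequence $\{x_n\}_n$ converges to $x$. *)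

(* Defs.v *)
From HB Require Import structures.
From mathcomp Require Import all_boot all_order all_algebra generic_quotient.
From mathcomp Require Import all_classical reals topology.

Set Implicit Arguments.
Unset Strict Implicit.
Unset Printing Implicit Defensive.

Import Order.TTheory GRing.Theory Num.Theory.
Local Open Scope classical_set_scope.

Declare Scope gyro_scope.
Delimit Scope gyro_scope with gyro.
Local Open Scope gyro_scope.

Reserved Notation "x ⊕ y" (at level 50, left associativity).
Reserved Notation "⊖ x" (at level 35, right associativity).
Reserved Notation "gyr[ x , y ]" (at level 0, format "gyr[ x ,  y ]").

(* The uniqueness clauses of (G1) and (G2) are part of the definition, although
   they follow from the other axioms. By left cancellation, [gyr] is determined
   by [addgyrA], so carrying it as an operation adds no structure. *)
HB.mixin Record isGyrogroup G := {
  gyro0 : G ;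
  gyroN : G -> G ;
  gyroD : G -> G -> G ;
  gyr : G -> G -> G -> G ;
  gyro_add0x : forall a, gyroD gyro0 a = a ;
  gyro_addx0 : forall a, gyroD a gyro0 = a ;
  gyro0_unique : forall e,
    (forall a, gyroD e a = a /\ gyroD a e = a) -> e = gyro0 ;
  gyro_addNx : forall x, gyroD (gyroN x) x = gyro0 ;
  gyro_addxN : forall x, gyroD x (gyroN x) = gyro0 ;
  gyroN_unique : forall x y,
    gyroD y x = gyro0 -> gyroD x y = gyro0 -> y = gyroN x ;
  gyr_bij : forall x y, bijective (gyr x y) ;
  gyr_morph : forall x y, {morph gyr x y : a b / gyroD a b} ;
  gyro_addA : forall x y z,
    gyroD x (gyroD y z) = gyroD (gyroD x y) (gyr x y z) ;
  gyr_loop : forall x y, gyr (gyroD x y) y = gyr x y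
}.

#[short(type="gyrogroupType")]
HB.structure Definition Gyrogroup := {G of isGyrogroup G}.

Arguments gyro0 {s}.
Notation "x ⊕ y" := (gyroD x y) : gyro_scope.
Notation "⊖ x" := (gyroN x) : gyro_scope.
Notation "gyr[ x , y ]" := (gyr x y) : gyro_scope.

HB.mixin Record isTopologicalGyrogroup G & Gyrogroup G & Topological G := {
  gyroD_continuous : continuous (fun xy : G * G => xy.1 ⊕ xy.2) ;
  gyroN_continuous : continuous (fun x : G => ⊖ x)
}.

#[short(type="topologicalGyrogroupType")]
HB.structure Definition TopologicalGyrogroup :=
  {G of Gyrogroup G & Topological G & isTopologicalGyrogroup G}.

(* Members of the base are neighborhoods of 0, not necessarily open. *)
Definition strong_symmetric_base (G : topologicalGyrogroupType)
    (U : set (set G)) : Prop :=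
  [/\ forall V, U V -> nbhs gyro0 V,
      forall W, nbhs gyro0 W -> exists2 V, U V & V `<=` W,
      forall V, U V -> [set ⊖ v | v in V] = V
    & forall V, U V -> forall x y, gyr[x, y] @` V = V].

Definition subgyrogroup (G : gyrogroupType) (H : set G) : Prop :=
  [/\ H !=set0,
      forall a, H a -> H (⊖ a)
    & forall a b, H a -> H b -> H (a ⊕ b)].

Definition gyro_setD (G : gyrogroupType) (A B : set G) : set G :=
  [set a ⊕ b | a in A & b in B].

Definition admissible_subgyrogroup (G : topologicalGyrogroupType)
    (U : set (set G)) (H : set G) : Prop :=
  subgyrogroup H /\
  exists V : nat -> set G,
    [/\ forall n, [/\ open (V n), V n gyro0, [set ⊖ v | v in V n] = V n
                    & U (V n)],
        forall n, gyro_setD (V n.+1) (gyro_setD (V n.+1) (V n.+1)) `<=` V n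
      & H = \bigcap_n V n].

Definition left_coset (G : gyrogroupType) (H : set G) (a : G) : set G :=
  [set a ⊕ h | h in H].

Definition left_cosets (G : gyrogroupType) (H : set G) : Type :=
  set_type (range (left_coset H)).

Section left_cosets_quotient.
Context {G : gyrogroupType} (H : set G).

Definition left_coset_pi (a : G) : left_cosets H :=
  SigSub (mem_set (imageT (left_coset H) a)).

Definition left_coset_repr (C : left_cosets H) : G :=
  sval (cid2 (set_mem (svalP C))).

Lemma left_coset_reprK : cancel left_coset_repr left_coset_pi.
Proof.
move=> C; apply/eq_sig_hprop => [? ? ?|/=]; first exact: bool_irrelevance.
by rewrite /left_coset_repr; case: cid2.
Qed.

HB.instance Definition _ :=
  isQuotient.Build G (left_cosets H) left_coset_reprK.

End left_cosets_quotient.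

(* The set G/H of the left cosets of H, with the quotient topology induced by
   a |-> a ⊕ H. The definition makes sense for every H, but the left cosets are
   known to partition G only when H is an L-subgyrogroup. *)
Definition coset_space (G : topologicalGyrogroupType) (H : set G)
    : topologicalType :=
  quotient_topology (left_cosets H).

Local Open Scope ring_scope.

Definition metrizable (R : realType) (T : topologicalType) : Prop :=
  exists d : T -> T -> R,
    [/\ forall x y, d x y = 0 <-> x = y,
        forall x y, d x y = d y x,
        forall x y z, d x z <= d x y + d y z
      & forall x (A : set T), nbhs x A <->
          exists2 e : R, 0 < e & [set y | d x y < e] `<=` A].

Definition strongly_frechet_urysohn (T : topologicalType) : Prop :=
  forall (x : T) (A : nat -> set T),
    (forall n, A n.+1 `<=` A n) ->
    (forall n, closure (A n) x) ->
    exists2 u : nat -> T, forall n, A n (u n) & u n @[n --> \oo] --> x.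

(* Main.v *)
(* By translation it suffices to work at 0. Since H is first countable, there
   are neighborhoods E_n of 0 in G such that (E_n ⊕ E_n) ∩ H shrinks to 0. Given
   a decreasing sequence A_n clustering at 0, let F_n = E_0 ∩ ... ∩ E_n and lift
   to b_n in A_n ∩ F_n a sequence of π(A_n ∩ F_n) converging to π(0). For every
   neighborhood Q of 0, the coset b_n ⊕ H eventually meets Q, say at b_n ⊕ h_n;
   then h_n = ⊖b_n ⊕ (b_n ⊕ h_n) is a small element of H, and therefore b_n,
   which is b_n ⊕ h_n minus h_n up to a gyration, is small too. *)

Require Import Defs.
From mathcomp Require Import all_boot all_order all_algebra generic_quotient.
From mathcomp Require Import all_classical reals topology.
Import Order.TTheory GRing.Theory Num.Theory.
Set Implicit Arguments.
Unset Strict Implicit.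
Unset Printing Implicit Defensive.

Local Open Scope classical_set_scope.
Local Open Scope gyro_scope.
Local Open Scope quotient_scope.

Section gyrogroup_theory.
Context {G : gyrogroupType}.
Implicit Types x y z : G.

(** Adding [⊖ x] on the left turns [x ⊕ y] into [gyr[⊖ x, x] y], and gyrations are injective. *)
Lemma gyroD_inj x : injective (gyroD x).
Proof.
move=> y z eq_xyz; apply: (bij_inj (gyr_bij (⊖ x) x)).
by rewrite -[LHS]gyro_add0x -[RHS]gyro_add0x -(gyro_addNx x) -!gyro_addA eq_xyz.
Qed.

Lemma gyr0x x y : gyr[gyro0, x] y = y.
Proof.
by apply: (@gyroD_inj x); rewrite -{1}[x]gyro_add0x -gyro_addA gyro_add0x.
Qed.

(** The loop property makes [gyr[⊖ x, x]] equal to [gyr[gyro0, x]], which is the identity. *)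
Lemma gyroDK x : cancel (gyroD x) (gyroD (⊖ x)).
Proof.
by move=> y; rewrite gyro_addA gyro_addNx gyro_add0x -gyr_loop gyro_addNx gyr0x.
Qed.

Lemma gyroDNK x : cancel (gyroD (⊖ x)) (gyroD x).
Proof.
by move=> y; rewrite gyro_addA gyro_addxN gyro_add0x -gyr_loop gyro_addxN gyr0x.
Qed.

(** Right cancellation holds only up to a gyration; this is harmless inside gyration-invariant
    neighborhoods. *)
Lemma gyroD_gyrNK x y : (x ⊕ y) ⊕ gyr[x, y] (⊖ y) = x.
Proof. by rewrite -gyro_addA gyro_addxN gyro_addx0. Qed.

End gyrogroup_theory.

Section topological_gyrogroup_theory.
Context {G : topologicalGyrogroupType}.
Implicit Types (x y : G) (H : set G).

Lemma gyroDl_continuous x : continuous (fun y => x ⊕ y).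
Proof.
move=> y; apply: (@cvg_comp _ _ _ (fun z => (x, z)) (fun p => p.1 ⊕ p.2)).
  by apply: (@cvg_pair _ _ _ (nbhs y) (nbhs x) (nbhs y)); first exact: cvg_cst.
exact: (@gyroD_continuous G (x, y)).
Qed.

Lemma gyroDr_continuous x : continuous (fun y => y ⊕ x).
Proof.
move=> y; apply: (@cvg_comp _ _ _ (fun z => (z, x)) (fun p => p.1 ⊕ p.2)).
  by apply: (@cvg_pair _ _ _ (nbhs y) (nbhs y) (nbhs x)); last exact: cvg_cst.
exact: (@gyroD_continuous G (y, x)).
Qed.

Lemma nbhs_gyroD (W : set G) : nbhs gyro0 W ->
  exists2 V : set G, nbhs gyro0 V & forall x y, V x -> V y -> W (x ⊕ y).
Proof.
move=> nW.
have := @gyroD_continuous G (gyro0, gyro0) W.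
rewrite /= gyro_add0x => /(_ nW) [[A B] [/= nA nB] sAB].
exists (A `&` B) => [|x y [Ax _] [_ By]]; first exact: filterI.
exact: (sAB (x, y)).
Qed.

Lemma strongly_frechet_urysohn_gyro0 :
  (forall A : nat -> set G, (forall n, A n.+1 `<=` A n) ->
     (forall n, closure (A n) gyro0) ->
     exists2 u : nat -> G, forall n, A n (u n) &
       u n @[n --> \oo] --> (gyro0 : G)) ->
  strongly_frechet_urysohn G.
Proof.
move=> sfu0 x A decrA clA.
have [n y /decrA//|n B nB|u Au u0] := sfu0 (fun n => gyroD x @^-1` A n).
  have : nbhs x (gyroD (⊖ x) @^-1` B).
    by apply: gyroDl_continuous; rewrite gyro_addNx.
  move=> /(clA n)[y [Ay By]]; exists (⊖ x ⊕ y); split => //.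
  by rewrite /= gyroDNK.
exists (fun n => x ⊕ u n) => //.
have := cvg_comp _ _ u0 (@gyroDl_continuous x gyro0).
by rewrite gyro_addx0.
Qed.

Lemma pi_coset_space H x : \pi_(coset_space H) x = left_coset_pi H x.
Proof. by rewrite unlock. Qed.

Lemma near_coset_space H x (Q : set G) : H gyro0 -> nbhs x Q ->
  \forall C \near (\pi_(coset_space H) x), exists2 q, set_val C q & Q q.
Proof.
move=> H0; rewrite nbhsE => -[P [oP Px] sPQ].
pose N : set (coset_space H) := [set C | exists2 q, set_val C q & P q].
(* A coset [a ⊕ H] meets [P] exactly when some right translation by an [h] in [H] sends [a] into
   [P], so continuity of right translations makes [N] open. *)
have NE : \pi_(coset_space H) @^-1` N =
    \bigcup_(h in H) (fun a => a ⊕ h) @^-1` P.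
  apply/seteqP; split=> a; rewrite /preimage /= pi_coset_space.
    by move=> [_ [h Hh <-] Pah]; exists h.
  by move=> [h Hh Pah]; exists (a ⊕ h) => //; exists h.
have oN : open N.
  rewrite /open /= /quotient_open NE; apply: bigcup_open => h _.
  by apply: open_comp => // a _; exact: gyroDr_continuous.
have Nx : N (\pi_(coset_space H) x).
  exists x => //; rewrite pi_coset_space; exists gyro0 => //.
  exact: gyro_addx0.
by apply: filterS (open_nbhs_nbhs (conj oN Nx)) => C [q Cq /sPQ]; exists q.
Qed.

End topological_gyrogroup_theory.

(** The balls of radius 1/(n+1) around [x] in [A] contain traces of neighborhoods [W n] taken in
    [T]; only these traces shrink to [x]. *)
Lemma metrizable_subspace_countable_base {R : realType} {T : topologicalType}
    (A : set T) (x : T) : metrizable R (set_type A) -> A x ->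
  exists2 W : nat -> set T, forall n, nbhs x (W n) &
    forall P, nbhs x P -> exists n, W n `&` A `<=` P.
Proof.
move=> [d [_ _ _ dP]] Ax; pose a : set_type A := SigSub (mem_set Ax).
have nW n : exists2 W : set T, nbhs x W & forall y : set_type A,
    W (set_val y) -> (d a y < n.+1%:R^-1)%R.
  have : nbhs a [set y | (d a y < n.+1%:R^-1)%R].
    by apply/dP; exists n.+1%:R^-1%R; rewrite ?invr_gt0 ?ltr0n.
  rewrite [nbhs a]nbhsE => -[_ [[W oW <-] Wa] sW].
  by exists W => [|y /sW//]; exact: open_nbhs_nbhs (conj oW Wa).
have W n := cid2 (nW n).
exists (fun n => s2val (W n)) => [n|P nP]; first by case: (W n).
have /dP[e e0 sP] : nbhs a (set_val @^-1` P).
  exact: (@initial_continuous _ _ (set_val : set_type A -> T)).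
(* Truncation gives [e^-1 < n.+1], hence 1/(n+1) < [e]. *)
pose n := Num.truncn e^-1; exists n => y [Wy Ay].
pose b : set_type A := SigSub (mem_set Ay).
apply: (sP b); apply: lt_trans (s2valP' (W n) b Wy) _.
by rewrite invf_plt ?posrE// truncnS_gt.
Qed.

Theorem theorem4p7 (R : realType) (G : topologicalGyrogroupType)
    (U : set (set G)) (H : set G)
    (hausG : hausdorff_space G)
    (baseU : strong_symmetric_base U)
    (admH : admissible_subgyrogroup U H)
    (lcptH : locally_compact [set: set_type H])
    (metrH : metrizable R (set_type H))
    (sfuGH : strongly_frechet_urysohn (coset_space H)) :
  strongly_frechet_urysohn G.
Proof.
have [[[a Ha] HN HD] _] := admH; have [nU baseU0 UN Ugyr] := baseU.
have H0 : H gyro0 by rewrite -(gyro_addxN a); apply: HD => //; exact: HN.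
have UNP V v : U V -> V v -> V (⊖ v).
  by move=> UV Vv; rewrite -(UN _ UV); exists v.
have UgyrP V x y v : U V -> V v -> V (gyr[x, y] v).
  by move=> UV Vv; rewrite -(Ugyr _ UV x y); exists v.
have U_D (W : set G) : nbhs gyro0 W ->
    exists V, U V /\ forall x y, V x -> V y -> W (x ⊕ y).
  move=> /nbhs_gyroD[V /baseU0[V' UV' sV'] VW].
  by exists V'; split=> // x y /sV' ? /sV'; exact: VW.
have [W nW baseW] := metrizable_subspace_countable_base metrH H0.
have /choice[E EP] := fun n => U_D _ (nW n).
apply: strongly_frechet_urysohn_gyro0 => A decrA clA.
(* The index [n] is included, so [F n] lies in [E m] as soon as [m <= n]. *)
pose F n := \bigcap_(i < n.+1) E i.
have nF n : nbhs gyro0 (F n).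
  rewrite /F bigcap_mkord; apply: big_ind => [|? ?|i _]; first exact: filterT.
    exact: filterI.
  by apply: nU; have [] := EP i.
have [n|n N nN|u Bu u0] := sfuGH (\pi_(coset_space H) gyro0)
    (fun n => \pi_(coset_space H) @` (A n `&` F n)).
- move=> _ [x [/decrA Ax Fx] <-]; exists x => //; split=> // i /= lt_in.
  exact/Fx/leqW.
- have nN0 : nbhs gyro0 (\pi_(coset_space H) @^-1` N) by exact: pi_continuous.
  have [x [Ax [Fx Nx]]] := clA n _ (filterI (nF n) nN0).
  by exists (\pi x); split=> //; exists x.
have /choice[b bP] : forall n, exists b, (A n `&` F n) b /\ \pi b = u n.
  by move=> n; have [b] := Bu n; exists b.
exists b => [n|O nO]; first by have [[]] := bP n.
have [P [UP PO]] := U_D _ nO.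
(* The target [O] determines [P], and [P] determines [m]. The cosets must then meet both [P], for
   the final sum, and [E m], to control [h]. *)
have [m WP] := baseW _ (nU _ UP).
have [UE EW] := EP m.
have [k _ kP] :=
  u0 _ (near_coset_space H0 (filterI (nU _ UP) (nU _ UE))).
(* Beyond [k] the coset of [b n] meets [P] and [E m] at a common point; beyond [m] the point [b n]
   itself lies in [E m]. *)
exists (maxn k m) => // n /=; rewrite geq_max => /andP[le_kn le_mn].
have [[_ Fb] piE] := bP n.
have [q] := kP n le_kn; rewrite /= -piE pi_coset_space => -[h Hh <-] [Pq Eq].
have Ph : P h.
  apply: WP; split=> //; rewrite -(gyroDK (b n) h); apply: EW => //.
  by apply: UNP => //; exact: Fb.
(* Since [P] belongs to [U], it contains [gyr[b n, h] (⊖ h)] along with [h]. *)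
rewrite /= -(gyroD_gyrNK (b n) h); apply: PO => //.
by apply: UgyrP => //; exact: UNP.
Qed.
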